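(* Let $\Omega\subset\mathbb R^n$ be a bounded domain, $1\le m\le n$, $T>0$, $Q_T=\Omega\times(0,T)$, $\partial'Q_T=(\Omega\times\{0\})\cup(\partial\Omega\times[0,T])$, $f$ a function on $\bar Q_T$ and $\varphi$ a function on $\partial'Q_T$ with $\varphi(\cdot,0)\in C^2(\Omega)$. Assume that $f\ge\nu_m>0$ on $\bar Q_T$, that there is a point $x_0\in\Omega$ such that $\varphi_{xx}(x_0,0)$ is $(m-1)$-positive, and that there is a point $x_1\in\Omega$ such that $\varphi_{xx}(x_1,0)$ is not $(m-1)$-positive. Then there is no $u\in C^{2,1}(\bar Q_T)$ with $E_m[u]=f$ in $\bar Q_T$ and $u=\varphi$ on $\partial'Q_T$, no matter how small $T>0$ is.
   Context: For $S\in\mathrm{Sym}(n)$ and $0\le p\le n$, $T_p(S)$ is the sum of all principal $p\times p$ minors of $S$, with $T_0(S)=1$. For $1\le k\le n$, $K_k=\{S\in\mathrm{Sym}(n):T_p(S)>0,\ p=1,\dots,k\}$; $S$ is $k$-positive if $S\in K_k$; by convention every matrix is $0$-positive. For $u(x,t)$, $u_{xx}$ is its Hessian in $x$ and $E_m[u]=-u_t\,T_{m-1}(u_{xx})+T_m(u_{xx})$. *)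

(* Defs.v *)
From Stdlib Require Import Reals.
From mathcomp Require Import all_boot all_fingroup.
Set Implicit Arguments. Unset Strict Implicit. Unset Printing Implicit Defensive.

Local Open Scope R_scope.

Definition Rn (n : nat) := 'I_n -> R.

Definition sqmat (n : nat) := 'I_n -> 'I_n -> R.

Definition principal_minor (n : nat) (A : sqmat n) (S : {set 'I_n}) : R :=
  \big[Rplus/0]_(s : {perm 'I_#|S|})
     ((if odd_perm s then -1 else 1) *
      \big[Rmult/1]_(i : 'I_#|S|) A (enum_val i) (enum_val (s i))).

(* T_p(A) : sum of all principal p x p minors (T_0 = 1 automatically). *)
Definition Tp (n : nat) (p : nat) (A : sqmat n) : R :=
  \big[Rplus/0]_(S : {set 'I_n} | #|S| == p) principal_minor A S.

(* A is k-positive: T_p(A) > 0 for p = 1..k (every matrix is 0-positive). *)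
Definition kpositive (n : nat) (k : nat) (A : sqmat n) : Prop :=
  forall p : nat, (1 <= p)%nat -> (p <= k)%nat -> 0 < Tp p A.

Definition Em (n : nat) (m : nat) (ut : R) (uxx : sqmat n) : R :=
  - ut * Tp (m.-1) uxx + Tp m uxx.

Definition sqnorm (n : nat) (x : Rn n) : R := \big[Rplus/0]_(i : 'I_n) (x i * x i).
Definition dist (n : nat) (x y : Rn n) : R := sqrt (sqnorm (fun i => x i - y i)).
Definition dist2 (n : nat) (x : Rn n) (t : R) (y : Rn n) (s : R) : R :=
  sqrt (sqnorm (fun i => x i - y i) + (t - s) * (t - s)).

Definition is_open (n : nat) (U : Rn n -> Prop) : Prop :=
  forall x, U x -> exists r, 0 < r /\ forall y, dist x y < r -> U y.

Definition is_bounded (n : nat) (U : Rn n -> Prop) : Prop :=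
  exists M, forall x, U x -> sqnorm x <= M.

Definition is_connected_open (n : nat) (U : Rn n -> Prop) : Prop :=
  forall A B : Rn n -> Prop, is_open A -> is_open B ->
    (forall x, U x <-> (A x \/ B x)) -> (forall x, ~ (A x /\ B x)) ->
    (forall x, ~ A x) \/ (forall x, ~ B x).

Definition bounded_domain (n : nat) (U : Rn n -> Prop) : Prop :=
  is_open U /\ is_connected_open U /\ is_bounded U /\ exists x, U x.

Definition closure (n : nat) (U : Rn n -> Prop) (x : Rn n) : Prop :=
  forall eps, 0 < eps -> exists y, U y /\ dist x y < eps.

Definition boundary (n : nat) (U : Rn n -> Prop) (x : Rn n) : Prop :=
  closure U x /\ ~ U x.

Definition QT (n : nat) (Om : Rn n -> Prop) (T : R) (x : Rn n) (t : R) : Prop :=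
  Om x /\ 0 < t < T.
Definition QTbar (n : nat) (Om : Rn n -> Prop) (T : R) (x : Rn n) (t : R) : Prop :=
  closure Om x /\ 0 <= t <= T.
Definition parab_bd (n : nat) (Om : Rn n -> Prop) (T : R) (x : Rn n) (t : R) : Prop :=
  (Om x /\ t = 0) \/ (boundary Om x /\ 0 <= t <= T).

Definition shift (n : nat) (x : Rn n) (i : 'I_n) (h : R) : Rn n :=
  fun k => if k == i then x k + h else x k.

Definition is_partial (n : nat) (g : Rn n -> R) (i : 'I_n) (x : Rn n) (l : R) : Prop :=
  derivable_pt_lim (fun h => g (shift x i h)) 0 l.

Definition cont_on (n : nat) (U : Rn n -> Prop) (g : Rn n -> R) : Prop :=
  forall x, U x -> forall eps, 0 < eps -> exists delta, 0 < delta /\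
    forall y, U y -> dist x y < delta -> Rabs (g y - g x) < eps.

Definition C2_on (n : nat) (U : Rn n -> Prop) (g : Rn n -> R)
    (G : 'I_n -> Rn n -> R) (H : 'I_n -> 'I_n -> Rn n -> R) : Prop :=
  (forall x, U x -> forall i, is_partial g i x (G i x)) /\
  (forall x, U x -> forall i j, is_partial (G i) j x (H i j x)) /\
  cont_on U g /\ (forall i, cont_on U (G i)) /\ (forall i j, cont_on U (H i j)).

Definition cont_on2 (n : nat) (S : Rn n -> R -> Prop) (w : Rn n -> R -> R) : Prop :=
  forall x t, S x t -> forall eps, 0 < eps -> exists delta, 0 < delta /\
    forall y s, S y s -> dist2 x t y s < delta -> Rabs (w y s - w x t) < eps.

(* u in C^{2,1}(closure Q_T): the derivatives u_{x_i} = Ux i, u_{x_i x_j} = Uxx i j,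
   u_t = Ut exist in Q_T and, together with u, extend continuously to the closure. *)
Definition C21_bar (n : nat) (Om : Rn n -> Prop) (T : R) (u : Rn n -> R -> R)
    (Ux : 'I_n -> Rn n -> R -> R) (Uxx : 'I_n -> 'I_n -> Rn n -> R -> R)
    (Ut : Rn n -> R -> R) : Prop :=
  (forall x t, QT Om T x t -> forall i, is_partial (fun y => u y t) i x (Ux i x t)) /\
  (forall x t, QT Om T x t -> forall i j,
      is_partial (fun y => Ux i y t) j x (Uxx i j x t)) /\
  (forall x t, QT Om T x t -> derivable_pt_lim (fun s => u x s) t (Ut x t)) /\
  cont_on2 (QTbar Om T) u /\ (forall i, cont_on2 (QTbar Om T) (Ux i)) /\
  (forall i j, cont_on2 (QTbar Om T) (Uxx i j)) /\ cont_on2 (QTbar Om T) Ut.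

(* Main.v *)
From Stdlib Require Import Reals Lra FunctionalExtensionality Classical.
From Coquelicot Require Import Coquelicot.
From mathcomp Require Import all_boot all_order all_fingroup all_algebra.
From mathcomp Require Import complex Rstruct zify.
From mathcomp Require ring.
Require Import Defs.
Set Implicit Arguments. Unset Strict Implicit. Unset Printing Implicit Defensive.

(* At t = 0 the Hessian of u is that of phi(., 0), as u_x and u_xx are continuous up to t = 0.
   Since Omega is connected, some x in Omega is a limit of points where phi_xx is (m-1)-positive
   while phi_xx(x, 0) is not.  Newton's inequality T_(k-1) T_(k+1) <= T_k^2 for symmetric matrices
   makes the ratios T_(k+1) / T_k decreasing on K_(m-1); letting the first of T_1, ..., T_(m-1)
   that vanishes at x tend to 0 gives T_(m-1) = 0 and T_m <= 0 at x.  There E_m[u] = T_m <= 0,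
   against E_m[u] = f > 0.
   Newton's inequality holds because det(1 + t S) = sum_p T_p(S) t^p has only real roots, a
   property inherited by all derivatives. *)

(** * Polynomials with real roots *)

Section RealRooted.
Import ring.
Import Order.TTheory GRing.Theory Num.Theory.
Local Open Scope ring_scope.

Variable C : numClosedFieldType.
Implicit Types (p : {poly C}) (rs : seq C).

(** The constant may vanish, so the zero polynomial counts as split. This keeps the class closed
    under derivation. *)
Definition real_split p :=
  exists c rs, [/\ c \is Num.real, all (fun r => r \is Num.real) rs &
                   p = c *: \prod_(r <- rs) ('X - r%:P)].

(* p'(z) / p(z) is the sum of the 1 / (z - r), whose imaginary parts all have the sign of -Im z;
   multiplying by |p(z)|^2 avoids the divisions. *)
Lemma im_logderiv_prod_XsubC (z : C) rs :
  z \isn't Num.real -> all (fun r => r \is Num.real) rs ->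
  let p := \prod_(r <- rs) ('X - r%:P) in
  'Im z * 'Im (p^`().[z] * (p.[z])^*) <= 0
    ?= iff (rs == [::]).
Proof.
move=> zNreal; elim: rs => [_|r rs IH] /=.
  by rewrite big_nil derivC horner0 mul0r raddf0 mulr0; apply/leifP; rewrite eqxx.
case/andP=> r_real rs_real; have [/= le0 _] := IH rs_real.
rewrite big_cons; set p := \prod_(j <- rs) _ in le0 *.
have pz0 : p.[z] != 0.
  rewrite -[_ == _]/(root p z) root_prod_XsubC; apply: contra zNreal.
  exact: (allP rs_real).
(* By the product rule, the new root adds a term with imaginary part -|p(z)|^2 Im z. It is nonzero
   because p has no nonreal root, which makes the inequality strict as soon as there is one root. *)
have -> : ((('X - r%:P) * p)^`().[z] * ((('X - r%:P) * p).[z])^*)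
   = (`|p.[z]| ^+ 2) * (z - r)^* + (`|z - r| ^+ 2) * (p^`().[z] * (p.[z])^*).
  rewrite derivM derivXsubC mul1r hornerD !hornerM hornerXsubC !normCK rmorphM /=.
  set a := p.[z]; set b := (a)^*; set d := (z - r)^*; set e := p^`().[z].  ring.
have Rn2 (x : C) : `|x| ^+ 2 \is Num.real by rewrite rpredX // normr_real.
have ImD (x y : C) : 'Im (x + y) = 'Im x + 'Im y by exact: raddfD.
rewrite ImD !(ImMl (Rn2 _)) Im_conj ImD raddfN /= (Creal_ImP _ r_real) subr0.
apply/leifP => /=.
rewrite mulrDr [X in X + _]mulrCA [X in _ + X]mulrCA mulrN mulrN.
have Imz0 : 'Im z != 0 by apply: contra zNreal => /eqP/Creal_ImP.
rewrite addrC subr_lt0; apply: (@le_lt_trans _ _ 0).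
  by rewrite mulr_ge0_le0 // exprn_ge0.
rewrite mulr_gt0 ?exprn_gt0 ?normr_gt0 //.
by rewrite -expr2 real_exprn_even_gt0 // Creal_Im.
Qed.

Lemma real_split_over p : p \is a polyOver Num.real ->
  (forall z, root p z -> z \is Num.real) -> real_split p.
Proof.
move=> /polyOverP p_real root_real.
have [rs def_p] := closed_field_poly_normal p; exists (lead_coef p).
have [p0 | pN0] := eqVneq p 0.
  by exists [::]; rewrite p0 lead_coef0 rpred0 scale0r.
exists rs; split; [exact: p_real | | exact: def_p].
apply/allP=> r rs_r; apply: root_real.
by rewrite def_p rootZ ?lead_coef_eq0 // root_prod_XsubC.
Qed.

(* Gauss--Lucas *)
Lemma real_split_deriv p : real_split p -> real_split p^`().
Proof.
move=> [c [rs [c_real rs_real ->]]]; set q := \prod_(r <- rs) _.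
have [-> | cN0] := eqVneq c 0.
  by rewrite scale0r deriv0; exists 0, [::]; rewrite rpred0 scale0r.
have [rs0 | rsN0] := eqVneq rs [::].
  exists 0, [::]; rewrite rpred0 scale0r /q rs0 big_nil.
  by rewrite -[c *: 1]mul_polyC mulr1 derivC.
apply: real_split_over.
  apply: polyOver_deriv; rewrite -mul_polyC rpredM ?polyOverC //.
  rewrite /q big_seq rpred_prod // => r rs_r.
  by rewrite polyOverXsubC (allP rs_real).
(* A nonreal root of q' would give the equality case of [im_logderiv_prod_XsubC], which forces [rs]
   to be empty. *)
move=> z; rewrite derivZ rootZ // => /rootP q'z.
apply: contraLR isT => zNreal.
have [_] := im_logderiv_prod_XsubC zNreal rs_real.
by rewrite -/q q'z mul0r raddf0 mulr0 eqxx (negPf rsN0).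
Qed.

Lemma real_split_coef_real p i : real_split p -> p`_i \is Num.real.
Proof.
move=> [c [rs [c_real rs_real ->]]]; rewrite coefZ rpredM //.
move: i; apply/polyOverP; rewrite big_seq rpred_prod // => r rs_r.
by rewrite polyOverXsubC (allP rs_real).
Qed.

(** Induction on the roots: multiplying q by X - r turns D = q_1^2 - 2 q_0 q_2 into q_0^2 + r^2 D,
    which stays nonnegative. *)
Lemma newton_coef0 p : real_split p -> p`_0 * p`_2 *+ 2 <= p`_1 ^+ 2.
Proof.
move=> [c [rs [c_real rs_real ->]]]; rewrite !coefZ exprMn.
rewrite mulrACA -expr2 -mulrnAr ler_wpM2l ?real_exprn_even_ge0 //.
elim: rs rs_real => [_|r rs IH] /=; first by rewrite big_nil !coef1 mulr0 mul0rn expr0n.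
case/andP=> r_real rs_real; move/(_ rs_real): IH; rewrite big_cons.
set q := \prod_(j <- rs) _ => IH; rewrite !mulrBl !coefB !coefXM !coefCM /=.
have q_real i : q`_i \is Num.real.
  move: i; apply/polyOverP; rewrite /q big_seq rpred_prod // => s rs_s.
  by rewrite polyOverXsubC (allP rs_real).
rewrite -subr_ge0 (_ : _ - _ = q`_0 ^+ 2 + r ^+ 2 * (q`_1 ^+ 2 - q`_0 * q`_2 *+ 2)).
  by apply: addr_ge0; [|apply: mulr_ge0]; rewrite ?subr_ge0 ?real_exprn_even_ge0.
ring.
Qed.

(** Derivation preserves real splitting and shifts the coefficients down by one, so the case k + 1
    for p is the case k for p'. The factors it brings in leave (k+1)(k+2) on both sides, which
    cancels. *)
Lemma newton_coef p k : real_split p ->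
  p`_k * p`_k.+2 *+ k.+2 <= p`_k.+1 ^+ 2 *+ k.+1.
Proof.
elim: k p => [|k IH] p rp; first by rewrite mulr1n newton_coef0.
have := IH _ (real_split_deriv rp); rewrite !coef_deriv exprMn_n mulrnAl mulrnAr.
rewrite -!mulrnA (_ : (k.+2 ^ 2 * k.+1)%N = (k.+2 * (k.+1 * k.+2))%N); last by lia.
by rewrite mulrnA [X in _ <= X]mulrnA ler_pMn2r.
Qed.

Lemma newton_coef_weak p k : real_split p ->
  p`_k * p`_k.+2 <= p`_k.+1 ^+ 2.
Proof.
move=> rp; have cr i := real_split_coef_real i rp.
have [le0 | ge0] := real_leP (rpredM (cr k) (cr k.+2)) (rpred0 _).
  by apply: le_trans le0 _; rewrite real_exprn_even_ge0.
rewrite -(@ler_pMn2r _ k.+1) // (le_trans _ (newton_coef k rp)) //.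
by rewrite ler_wpMn2l // ltW.
Qed.
End RealRooted.

(** * Sums of principal minors *)

Section PrincipalMinors.
Import GRing.Theory.
Local Open Scope ring_scope.

Definition det_minor (K : comNzRingType) n (A : 'M[K]_n) (S : {set 'I_n}) : K :=
  \det (mxsub (@enum_val _ (mem S)) (@enum_val _ (mem S)) A).

(** Rows and columns undergo the same permutation, so its sign enters squared. *)
Lemma det_mxsub_bij (K : comNzRingType) p n (h : 'I_p -> 'I_n) (A : 'M[K]_n) :
  bijective h -> \det (mxsub h h A) = \det A.
Proof.
move=> h_bij; have := bij_eq_card h_bij; rewrite !card_ord => def_p.
subst p; pose s := perm (bij_inj h_bij).
have -> : mxsub h h A = row_perm s (col_perm s A).
  by apply/matrixP=> i j; rewrite !mxE !permE.
rewrite row_permE col_permE !det_mulmx !det_perm.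
by rewrite odd_permV mulrC -mulrA -expr2 sqrr_sign mulr1.
Qed.

(* Listing the indices of S first makes the matrix block triangular with an identity block. *)
Lemma det_mask_rows (K : comNzRingType) n (A : 'M[K]_n) (S : {set 'I_n}) :
  \det (\matrix_(i, j) if i \in S then A i j else (i == j)%:R) = det_minor A S.
Proof.
set M := \matrix_(i, j) _.
pose h (i : 'I_(#|S| + #|~: S|)) : 'I_n :=
  match split i with inl a => enum_val a | inr b => enum_val b end.
have hl a : h (lshift _ a) = enum_val a.
  by rewrite /h (unsplitK (inl a)).
have hr b : h (rshift _ b) = enum_val b.
  by rewrite /h (unsplitK (inr b)).
have h_inj : injective h.
  move=> i j; rewrite -(splitK i) -(splitK j).
  case: (split i) => a; case: (split j) => b; rewrite /= ?hl ?hr.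
  - by move/enum_val_inj->.
  - by move=> eq_ab; have := enum_valP b; rewrite -eq_ab inE enum_valP.
  - by move=> eq_ab; have := enum_valP a; rewrite eq_ab inE enum_valP.
  - by move/enum_val_inj->.
have h_bij : bijective h.
  by apply: inj_card_bij => //; rewrite !card_ord cardsC card_ord.
rewrite -(det_mxsub_bij M h_bij) -[mxsub h h M]submxK.
have -> : dlsubmx (mxsub h h M) = 0.
  apply/matrixP=> i j; rewrite !mxE hl hr.
  have := enum_valP i; rewrite inE => /negPf ->.
  case: eqP => // eq_ij; have := enum_valP i.
  by rewrite eq_ij inE enum_valP.
have -> : drsubmx (mxsub h h M) = 1%:M.
  apply/matrixP=> i j; rewrite !mxE !hr.
  have := enum_valP i; rewrite inE => /negPf ->.
  by rewrite (inj_eq enum_val_inj).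
rewrite det_ublock det1 mulr1; congr (\det _).
by apply/matrixP=> i j; rewrite !mxE !hl enum_valP.
Qed.

Lemma det_minorZ (K : comNzRingType) n (t : K) (A : 'M[K]_n) S :
  det_minor (t *: A) S = t ^+ #|S| * det_minor A S.
Proof.
by rewrite /det_minor -detZ; congr (\det _); apply/matrixP=> i j; rewrite !mxE.
Qed.

(** In the Leibniz formula each factor is an entry of 1 plus an entry of t A. Expanding the product
    sorts the terms by the set S of rows where t A is chosen, and the terms of a given S form the
    determinant of [det_mask_rows]. *)
Lemma det_add1Z (K : comNzRingType) n (t : K) (A : 'M[K]_n) :
  \det (1%:M + t *: A) = \sum_(S : {set 'I_n}) t ^+ #|S| * det_minor A S.
Proof.
under [RHS]eq_bigr => S _ do rewrite -det_minorZ -det_mask_rows /determinant.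
rewrite exchange_big /=; apply: eq_bigr => s _; rewrite -big_distrr /=.
congr (_ * _); under eq_bigr => i _ do rewrite mxE addrC.
rewrite bigA_distr; apply: eq_bigr => S _; apply: eq_bigr => i _.
by rewrite !mxE.
Qed.

Definition sum_minors (K : comNzRingType) n p (A : 'M[K]_n) : K :=
  \sum_(S : {set 'I_n} | #|S| == p) det_minor A S.

Lemma coef_det_add1Z (K : comNzRingType) n (A : 'M[K]_n) p :
  (\det (1%:M + 'X *: map_mx polyC A))`_p = sum_minors p A.
Proof.
rewrite det_add1Z coef_sum /sum_minors [RHS]big_mkcond /=.
apply: eq_bigr => S _; rewrite /det_minor -map_mxsub det_map_mx mulrC mul_polyC.
by rewrite coefZ coefXn eq_sym; case: eqP; rewrite ?mulr1 ?mulr0.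
Qed.

End PrincipalMinors.

(** * Newton's inequality for symmetric matrices *)

Section SymmetricNewton.
Import Order.TTheory GRing.Theory Num.Theory.
Local Open Scope ring_scope.

Lemma real_split_det_sym (C : numClosedFieldType) n (A : 'M[C]_n) :
  (forall i j, A i j \is Num.real) -> A^T = A ->
  real_split (\det (1%:M + 'X *: map_mx polyC A)).
Proof.
move=> A_real A_sym; apply: real_split_over.
  apply/polyOverP=> p; rewrite coef_det_add1Z rpred_sum // => S _.
  rewrite rpred_sum // => s _; rewrite rpredM ?rpredX ?rpredN ?rpred1 //.
  by rewrite rpred_prod // => i _; rewrite mxE.
move=> z.
have -> : root (\det (1%:M + 'X *: map_mx polyC A)) z = (\det (1%:M + z *: A) == 0).
  rewrite /root -[X in X == 0](det_map_mx (horner_eval z)); congr (\det _ == 0).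
  apply/matrixP=> i j; rewrite !mxE /= /horner_eval hornerD hornerM hornerX hornerC.
  by rewrite hornerMn hornerC.
case/det0P=> v vN0; rewrite mulmxDr mulmx1 -scalemxAr => def_v.
pose w := (map_mx Num.conj v)^T.
(* v + z v A = 0 gives z = - (v v^* ) / (v A v^* ), a quotient of real numbers. *)
have N_gt0 : 0 < (v *m w) 0 0.
  rewrite mxE lt_def sumr_ge0 => [|i _]; last by rewrite !mxE mul_conjC_ge0.
  rewrite andbT psumr_eq0 => [|i _]; last by rewrite !mxE mul_conjC_ge0.
  apply: contra vN0 => /allP v0; apply/eqP/rowP=> i; rewrite mxE.
  by have := v0 i (mem_index_enum i); rewrite !mxE mul_conjC_eq0 => /eqP.
(* Being real and symmetric, [A] is Hermitian, so this number is its own conjugate. *)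
have q_real : (v *m A *m w) 0 0 \is Num.real.
  have conj_vAw : map_mx Num.conj (v *m A *m w) = (v *m A *m w)^T.
    rewrite !map_mxM !trmx_mul A_sym trmxK -mulmxA; congr (_ *m (_ *m _)).
      by apply/matrixP=> i j; rewrite mxE; apply/CrealP.
    by apply/matrixP=> i j; rewrite /w !mxE; apply: conjCK.
  by apply/CrealP; move/matrixP/(_ 0 0): conj_vAw; rewrite !mxE.
have := congr1 (fun M => (M *m w) 0 0) def_v; rewrite mulmxDl -scalemxAl mxE.
rewrite [X in _ + X]mxE mul0mx [RHS]mxE => /eqP; rewrite addr_eq0 => /eqP def_N.
have qN0 : (v *m A *m w) 0 0 != 0.
  by apply: contraTneq N_gt0 => q0; rewrite def_N q0 mulr0 oppr0 ltxx.
rewrite -[z](mulfK qN0) rpredM ?rpredV //.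
by rewrite -[z * _]opprK -def_N rpredN gtr0_real.
Qed.

Lemma sum_minors_map (K L : comNzRingType) (g : {rmorphism K -> L}) n p (A : 'M[K]_n) :
  sum_minors p (map_mx g A) = g (sum_minors p A).
Proof.
rewrite /sum_minors raddf_sum; apply: eq_bigr => S _.
by rewrite /det_minor -map_mxsub det_map_mx.
Qed.

(** The argument about roots needs a closed field, so [A] is moved to the complex numbers over [R];
    the embedding commutes with the minors and reflects the order. *)
Lemma newton_sum_minors (R : rcfType) n (A : 'M[R]_n) k : A^T = A ->
  sum_minors k A * sum_minors k.+2 A <= sum_minors k.+1 A ^+ 2.
Proof.
move=> A_sym.
have gA_real i j : map_mx (real_complex R) A i j \is Num.real.
  by rewrite mxE; apply/complex_realP; exists (A i j).
have gA_sym : (map_mx (real_complex R) A)^T = map_mx (real_complex R) A.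
  by apply/matrixP=> i j; rewrite !mxE -[in RHS]A_sym mxE.
have := newton_coef_weak k (real_split_det_sym gA_real gA_sym).
by rewrite !coef_det_add1Z !sum_minors_map -rmorphM -rmorphXn lecR.
Qed.
End SymmetricNewton.

Section TpNewton.
Import GRing.Theory.

Lemma Tp_sum_minors n p (A : sqmat n) :
  Tp p A = sum_minors p (\matrix_(i, j) A i j : 'M[R]_n)%R.
Proof.
apply: eq_bigr => S _; apply: eq_bigr => s _; congr (_ * _)%R.
  by rewrite -signr_odd; case: (odd_perm s); rewrite ?expr1 ?expr0.
by apply: eq_bigr => i _; rewrite !mxE.
Qed.

Lemma Tp0 n (A : sqmat n) : Tp 0 A = 1%R.
Proof.
rewrite Tp_sum_minors /sum_minors (big_pred1 set0) => [|S]; last by rewrite cards_eq0.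
by rewrite /det_minor; move: (mxsub _ _ _); rewrite cards0 => M; rewrite det_mx00.
Qed.

Lemma newton_Tp n (A : sqmat n) k : (forall i j, A i j = A j i) ->
  Rle (Rmult (Tp k A) (Tp k.+2 A)) (Rmult (Tp k.+1 A) (Tp k.+1 A)).
Proof.
move=> A_sym; rewrite !Tp_sum_minors; apply/RleP.
have := @newton_sum_minors R n (\matrix_(i, j) A i j)%R k.
rewrite expr2; apply; apply/matrixP=> i j; rewrite !mxE; exact: A_sym.
Qed.
End TpNewton.

Local Open Scope R_scope.

(** * Continuity of T_p and the boundary of the cone *)

Section Geometry.
Import GRing.Theory.

Lemma sqnorm_supp1 n (i : 'I_n) (z : Rn n) :
  (forall l, l != i -> z l = 0) -> sqnorm z = z i * z i.
Proof.
move=> z0; rewrite /sqnorm.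
have -> : \big[Rplus/0]_(l < n) (z l * z l) = (\sum_(l < n) z l * z l)%R by [].
rewrite (bigD1 i) //= big1 ?addr0 // => l /z0 ->; exact: mulr0.
Qed.

Lemma sqnorm_supp2 n (i j : 'I_n) (z : Rn n) : i != j ->
  (forall l, l != i -> l != j -> z l = 0) -> sqnorm z = z i * z i + z j * z j.
Proof.
move=> ij z0; rewrite /sqnorm.
have -> : \big[Rplus/0]_(l < n) (z l * z l) = (\sum_(l < n) z l * z l)%R by [].
rewrite (bigD1 i) //= (bigD1 j) 1?eq_sym //= big1 ?addr0 //.
by move=> l /andP[li lj]; rewrite z0 //; exact: mulr0.
Qed.

Lemma sqnorm_diag n (x : Rn n) : sqnorm (fun i => x i - x i) = 0.
Proof.
have -> : sqnorm (fun i => x i - x i) = (\sum_(l < n) 0)%R.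
  by apply: eq_bigr => i _; rewrite Rminus_diag Rmult_0_l.
by rewrite big1.
Qed.

End Geometry.

Lemma dist_xx n (x : Rn n) : dist x x = 0.
Proof. by rewrite /dist sqnorm_diag sqrt_0. Qed.

Lemma shift0 n (x : Rn n) i : shift x i 0 = x.
Proof.
by apply: functional_extensionality => k; rewrite /shift; case: (k == i) => //; lra.
Qed.

Lemma shift_shift n (x : Rn n) i a b : shift (shift x i a) i b = shift x i (a + b).
Proof.
by apply: functional_extensionality => k; rewrite /shift; case: (k == i) => //; lra.
Qed.

Lemma shift_comm n (x : Rn n) i j a b :
  shift (shift x i a) j b = shift (shift x j b) i a.
Proof.
apply: functional_extensionality => k; rewrite /shift.
by case: (k == i); case: (k == j) => //; lra.
Qed.

Lemma dist_shift n (x : Rn n) i h : dist x (shift x i h) = Rabs h.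
Proof.
rewrite /dist (@sqnorm_supp1 _ i) => [|l /negPf li]; last by rewrite /shift li; lra.
by rewrite /shift eqxx -[RHS]sqrt_Rsqr_abs; congr sqrt; rewrite /Rsqr; lra.
Qed.

Lemma sqrt_sum_sqr_le a b : sqrt (a * a + b * b) <= Rabs a + Rabs b.
Proof.
have a0 := Rabs_pos a; have b0 := Rabs_pos b.
rewrite -(sqrt_Rsqr (Rabs a + Rabs b)); last lra.
apply: sqrt_le_1_alt.
have := Rsqr_abs a; have := Rsqr_abs b; rewrite /Rsqr.
by have := Rmult_le_pos _ _ a0 b0; lra.
Qed.

Lemma dist_shift2 n (x : Rn n) i j a b : i != j ->
  dist x (shift (shift x i a) j b) <= Rabs a + Rabs b.
Proof.
move=> ij; rewrite /dist (@sqnorm_supp2 _ i j) // => [|l /negPf li /negPf lj]; last first.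
  by rewrite /shift li lj; lra.
rewrite /shift !eqxx (negPf ij) eq_sym (negPf ij).
apply: Rle_trans (sqrt_sum_sqr_le a b); right; congr sqrt; ring.
Qed.

Lemma dist2_shift n (x : Rn n) i h t s :
  dist2 x t (shift x i h) s <= Rabs h + Rabs (s - t).
Proof.
rewrite /dist2 (@sqnorm_supp1 _ i) => [|l /negPf li]; last by rewrite /shift li; lra.
rewrite /shift eqxx; apply: Rle_trans (sqrt_sum_sqr_le h (s - t)).
right; congr sqrt; ring.
Qed.

Lemma dist2_time n (x : Rn n) t s : dist2 x t x s = Rabs (s - t).
Proof.
rewrite /dist2 sqnorm_diag -[RHS]sqrt_Rsqr_abs; congr sqrt; rewrite /Rsqr; ring.
Qed.

Section ContOn.
Variables (n : nat) (U : Rn n -> Prop).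
Implicit Types g : Rn n -> R.

Lemma cont_on_ext g1 g2 : (forall x, g1 x = g2 x) -> cont_on U g1 -> cont_on U g2.
Proof. by move=> /functional_extensionality ->. Qed.

Lemma cont_on_const c : cont_on U (fun=> c).
Proof.
move=> x _ eps eps0; exists 1; split=> [|y _ _]; first lra.
by rewrite Rminus_diag Rabs_R0.
Qed.

Lemma cont_on_plus g1 g2 : cont_on U g1 -> cont_on U g2 ->
  cont_on U (fun x => g1 x + g2 x).
Proof.
move=> c1 c2 x Ux eps eps0.
have [d1 [d1_0 g1d]] := c1 x Ux (eps / 2) ltac:(lra).
have [d2 [d2_0 g2d]] := c2 x Ux (eps / 2) ltac:(lra).
exists (Rmin d1 d2); split=> [|y Uy xy]; first exact: Rmin_pos.
have := g1d y Uy (Rlt_le_trans _ _ _ xy (Rmin_l _ _)).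
have := g2d y Uy (Rlt_le_trans _ _ _ xy (Rmin_r _ _)).
rewrite /Rabs; do !case: Rcase_abs => ?; lra.
Qed.

Lemma cont_on_mult g1 g2 : cont_on U g1 -> cont_on U g2 ->
  cont_on U (fun x => g1 x * g2 x).
Proof.
move=> c1 c2 x Ux eps eps0.
(* If both factors change by less than e <= 1, the product changes by less than e^2 + e (|g1 x| +
   |g2 x|) <= e M <= eps. *)
set M := 1 + Rabs (g1 x) + Rabs (g2 x).
have a1 := Rabs_pos (g1 x); have a2 := Rabs_pos (g2 x).
have M0 : 0 < M by rewrite /M; lra.
set e := Rmin 1 (eps / M).
have e0 : 0 < e by apply: Rmin_pos; [lra | apply: Rdiv_lt_0_compat].
have e1 : e <= 1 by apply: Rmin_l.
have eM : e * M <= eps.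
  apply: (Rle_trans _ (eps / M * M)); last by right; field; lra.
  by apply: Rmult_le_compat_r; [lra | apply: Rmin_r].
have [d1 [d1_0 g1d]] := c1 x Ux e e0.
have [d2 [d2_0 g2d]] := c2 x Ux e e0.
exists (Rmin d1 d2); split=> [|y Uy xy]; first exact: Rmin_pos.
have h1 := g1d y Uy (Rlt_le_trans _ _ _ xy (Rmin_l _ _)).
have h2 := g2d y Uy (Rlt_le_trans _ _ _ xy (Rmin_r _ _)).
have -> : g1 y * g2 y - g1 x * g2 x =
    (g1 y - g1 x) * (g2 y - g2 x) + (g1 x * (g2 y - g2 x) + (g1 y - g1 x) * g2 x).
  ring.
apply: Rle_lt_trans (Rabs_triang _ _) _.
have := Rabs_triang (g1 x * (g2 y - g2 x)) ((g1 y - g1 x) * g2 x).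
rewrite !Rabs_mult.
have b1 := Rabs_pos (g1 y - g1 x); have b2 := Rabs_pos (g2 y - g2 x).
rewrite /M in eM; nra.
Qed.

(** The operation is left arbitrary to cover both the sums and the products in [Tp]. *)
Lemma cont_on_big (I : Type) (r : seq I) (P : pred I) op idx (F : I -> Rn n -> R) :
  (forall g1 g2, cont_on U g1 -> cont_on U g2 -> cont_on U (fun x => op (g1 x) (g2 x))) ->
  (forall i, P i -> cont_on U (F i)) ->
  cont_on U (fun x => \big[op/idx]_(i <- r | P i) F i x).
Proof.
move=> c_op c_F; elim: r => [|i r IH].
  by apply: cont_on_ext (cont_on_const idx) => x; rewrite big_nil.
case Pi: (P i).
  by apply: cont_on_ext (c_op _ _ (c_F i Pi) IH) => x; rewrite big_cons Pi.
by apply: cont_on_ext IH => x; rewrite big_cons Pi.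
Qed.

Lemma cont_on_Tp p (H : 'I_n -> 'I_n -> Rn n -> R) :
  (forall i j, cont_on U (H i j)) -> cont_on U (fun x => Tp p (fun i j => H i j x)).
Proof.
move=> cH; apply: cont_on_big => [|S _]; first exact: cont_on_plus.
apply: cont_on_big => [|s _]; first exact: cont_on_plus.
apply: cont_on_mult; first exact: cont_on_const.
by apply: cont_on_big => [|i _]; [exact: cont_on_mult | exact: cH].
Qed.

Lemma cont_on_le g1 g2 x : cont_on U g1 -> cont_on U g2 -> U x ->
  (forall r, 0 < r -> exists y, [/\ U y, dist x y < r & g1 y <= g2 y]) ->
  g1 x <= g2 x.
Proof.
move=> c1 c2 Ux lim; apply: Rnot_lt_le => lt21.
have c := cont_on_plus c1 (cont_on_mult (cont_on_const (-1)) c2).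
have [r [r0 near_x]] := c x Ux (g1 x - g2 x) ltac:(lra).
have [y [Uy xy le12]] := lim r r0.
by have := near_x y Uy xy; rewrite /Rabs; case: Rcase_abs => ?; lra.
Qed.

Lemma kpositive_near k (H : 'I_n -> 'I_n -> Rn n -> R) x :
  (forall i j, cont_on U (H i j)) -> U x -> kpositive k (fun i j => H i j x) ->
  exists r, 0 < r /\
    forall y, U y -> dist x y < r -> kpositive k (fun i j => H i j y).
Proof.
move=> cH Ux; elim: k => [|k IH] kpos.
  by exists 1; split=> [|y _ _ p p1 p0]; [lra | move: (leq_trans p1 p0)].
have [|r1 [r1_0 near1]] := IH; first by move=> p p1 pk; apply: kpos => //; exact: leqW.
have Tk := kpos k.+1 isT (leqnn _).
have [r2 [r2_0 near2]] := @cont_on_Tp k.+1 H cH x Ux _ Tk.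
exists (Rmin r1 r2); split=> [|y Uy xy p p1]; first exact: Rmin_pos.
rewrite leq_eqVlt ltnS => /orP[/eqP -> | pk].
  have := near2 y Uy (Rlt_le_trans _ _ _ xy (Rmin_r _ _)).
  by rewrite /Rabs; case: Rcase_abs => ?; lra.
exact: near1 (Rlt_le_trans _ _ _ xy (Rmin_l _ _)) _ p1 pk.
Qed.

End ContOn.

(** This is T_(j+1) / T_j <= T_(q+1) / T_q with denominators cleared, a form that survives in limits
    where some T_p vanish. The sign of T_(k+1), reached for j = k, is not known. *)
Lemma newton_chain n (A : sqmat n) k q j :
  (forall i l, A i l = A l i) -> kpositive k A -> (q <= j <= k)%nat ->
  Tp j.+1 A * Tp q A <= Tp q.+1 A * Tp j A.
Proof.
move=> A_sym kpos /andP[].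
have pos p : (p <= k)%nat -> 0 < Tp p A.
  by case: p => [|p] pk; [rewrite Tp0; exact: Rlt_0_1 | exact: kpos].
move=> /subnKC <-; elim: (j - q)%nat => [|d IH]; first by rewrite addn0; lra.
rewrite addnS => dk; have := IH (ltnW dk); have := newton_Tp (q + d)%nat A_sym.
have := pos _ dk; have := pos _ (ltnW dk).
have := pos q (leq_trans (leq_addr d q) (ltnW dk)).
set a := Tp (q + d)%nat A; set b := Tp (q + d).+1 A; set c := Tp (q + d).+2 A.
set u := Tp q A; set v := Tp q.+1 A => u0 a0 b0 ac bu.
(* Newton's inequality and the induction hypothesis give [a * c * u <= b * b * u <= b * v * a]; then
   [a > 0] cancels. *)
apply: (Rmult_le_reg_l a) => //.
by have := Rmult_le_compat_l u _ _ ltac:(lra) ac; nra.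
Qed.

Lemma Tp_boundary_cone n (U : Rn n -> Prop) (H : 'I_n -> 'I_n -> Rn n -> R) k x :
  (forall i j, cont_on U (H i j)) ->
  (forall y, U y -> forall i j, H i j y = H j i y) -> U x ->
  (forall r, 0 < r -> exists y,
     [/\ U y, dist x y < r & kpositive k (fun i j => H i j y)]) ->
  ~ kpositive k (fun i j => H i j x) ->
  Tp k (fun i j => H i j x) = 0 /\ Tp k.+1 (fun i j => H i j x) <= 0.
Proof.
move=> cH Hsym Ux lim Nkpos.
pose S y := fun i j => H i j y.
have cT p := cont_on_Tp p cH.
have T_ge0 p : (p <= k)%nat -> 0 <= Tp p (S x).
  case: p => [|p] pk; first by rewrite Tp0; exact: Rle_0_1.
  apply: (cont_on_le (cont_on_const (U := U) 0) (cT p.+1) Ux) => r r0.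
  have [y [Uy xy kpos]] := lim r r0; exists y; split=> //.
  exact: Rlt_le (kpos _ _ pk).
(* [q.+1] is the first index at which T_p vanishes at [x]; the search starts from T_0 = 1 > 0. *)
have [q [qk Tq0 Tq]] : exists q, [/\ (q < k)%nat, 0 < Tp q (S x) & Tp q.+1 (S x) = 0].
  have first_zero j : (j <= k)%nat -> (0 < Tp j (S x) /\ kpositive j (S x)) \/
      exists q, [/\ (q < k)%nat, 0 < Tp q (S x) & Tp q.+1 (S x) = 0].
    elim: j => [_|j IH jk].
      left; rewrite Tp0; split; first exact: Rlt_0_1.
      by move=> p p1 p0; move: (leq_trans p1 p0).
    have [[Tj kpos]|] := IH (ltnW jk); last by right.
    have [Tj1|Tj1] := T_ge0 _ jk; last by right; exists j.
    left; split=> // p p1; rewrite leq_eqVlt ltnS => /orP[/eqP -> // | pj].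
    exact: kpos.
  by have [[_ /Nkpos]|] := first_zero k (leqnn k).
(* In the limit the right side of [newton_chain] contains the factor T_(q+1) = 0, while T_q stays
   positive. *)
have T_le0 j : (q <= j <= k)%nat -> Tp j.+1 (S x) <= 0.
  move=> qjk; suff : Tp j.+1 (S x) * Tp q (S x) <= Tp q.+1 (S x) * Tp j (S x).
    by rewrite Tq => ?; nra.
  apply: (cont_on_le (cont_on_mult (cT _) (cT _)) (cont_on_mult (cT _) (cT _)) Ux).
  move=> r /lim[y [Uy xy kpos]]; exists y; split=> //.
  exact: newton_chain (Hsym y Uy) kpos qjk.
split; last by apply: T_le0; rewrite leqnn ltnW.
apply: Rle_antisym; last exact: T_ge0.
(* The case j = k - 1, admissible because q < k, bounds T_k itself from above. *)
by rewrite -(ltn_predK qk); apply: T_le0; rewrite -ltnS (ltn_predK qk) qk leq_pred.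
Qed.

(** Without such a point, the part of [U] where [P] fails would be open as well, and [U] would split
    into two disjoint nonempty open sets. *)
Lemma exists_frontier_point n (U P : Rn n -> Prop) x0 x1 :
  is_open U -> is_connected_open U ->
  (forall x, U x -> P x ->
     exists r, 0 < r /\ forall y, U y -> dist x y < r -> P y) ->
  U x0 -> P x0 -> U x1 -> ~ P x1 ->
  exists x, [/\ U x, ~ P x &
    forall r, 0 < r -> exists y, [/\ U y, dist x y < r & P y]].
Proof.
move=> oU cU oP Ux0 Px0 Ux1 NPx1; apply: NNPP => no_x.
have open_in : is_open (fun x => U x /\ P x).
  move=> x [Ux Px]; have [r1 [r1_0 Ur]] := oU x Ux; have [r2 [r2_0 Pr]] := oP x Ux Px.
  exists (Rmin r1 r2); split=> [|y xy]; first exact: Rmin_pos.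
  have Uy := Ur y (Rlt_le_trans _ _ _ xy (Rmin_l _ _)).
  by split=> //; apply: Pr Uy (Rlt_le_trans _ _ _ xy (Rmin_r _ _)).
have open_out : is_open (fun x => U x /\ ~ P x).
  move=> x [Ux NPx]; apply: NNPP => no_r; apply: no_x; exists x; split=> // r r0.
  apply: NNPP => no_y; apply: no_r; have [r1 [r1_0 Ur]] := oU x Ux.
  exists (Rmin r1 r); split=> [|y xy]; first exact: Rmin_pos.
  have Uy := Ur y (Rlt_le_trans _ _ _ xy (Rmin_l _ _)).
  split=> // Py; apply: no_y; exists y; split=> //.
  exact: Rlt_le_trans xy (Rmin_r _ _).
have cover x : U x <-> U x /\ P x \/ U x /\ ~ P x by have := classic (P x); tauto.
have disj x : ~ ((U x /\ P x) /\ U x /\ ~ P x) by tauto.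
case: (cU _ _ open_in open_out cover disj) => none; first exact: (none x0).
exact: (none x1).
Qed.

(** * Traces of derivatives at t = 0 and symmetry of the Hessian *)

(** Gives access to one-variable calculus along a whole coordinate line, although [is_partial]
    always differentiates at shift 0. *)
Lemma partial_shift n g (i : 'I_n) x a l :
  is_partial g i (shift x i a) l <-> is_derive (fun s => g (shift x i s)) a l.
Proof.
split=> [|/is_derive_Reals] d; [apply/is_derive_Reals|]; move=> eps /d[delta d_near];
  by exists delta => h h0 hd; have := d_near h h0 hd; rewrite !shift_shift Rplus_0_l Rplus_0_r.
Qed.

Lemma is_partial_unique n g (i : 'I_n) x l1 l2 :
  is_partial g i x l1 -> is_partial g i x l2 -> l1 = l2.
Proof. exact: uniqueness_limite. Qed.

Lemma is_partial_near n (U : Rn n -> Prop) g1 g2 (i : 'I_n) x l :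
  is_open U -> U x -> (forall y, U y -> g1 y = g2 y) ->
  is_partial g1 i x l -> is_partial g2 i x l.
Proof.
move=> oU Ux eq_g d1; have [r [r0 Ur]] := oU x Ux.
rewrite -(shift0 x i); apply/partial_shift; rewrite -(shift0 x i) in d1.
apply: is_derive_ext_loc (proj1 (partial_shift _ _ _ _ _) d1).
exists (mkposreal r r0) => h hr; apply: eq_g; apply: Ur; rewrite dist_shift.
have : Rabs (h - 0) < r by exact: hr.
by rewrite Rminus_0_r.
Qed.

Lemma closure_subset n (U : Rn n -> Prop) x : U x -> closure U x.
Proof. by move=> Ux eps eps0; exists x; rewrite dist_xx. Qed.

(* The mean value inequality |w(x + h e_i, t) - w(x, t) - W(x, 0) h| <= eps |h|, valid for small
   t > 0, passes to the limit t = 0. *)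
Lemma is_partial_initial n (Om : Rn n -> Prop) T (w W : Rn n -> R -> R) (i : 'I_n) x :
  is_open Om -> 0 < T ->
  (forall y t, QT Om T y t -> is_partial (fun z => w z t) i y (W y t)) ->
  cont_on2 (QTbar Om T) w -> cont_on2 (QTbar Om T) W -> Om x ->
  is_partial (fun z => w z 0) i x (W x 0).
Proof.
move=> oOm T0 dw cw cW Omx eps eps0.
have bar y t : Om y -> 0 <= t <= T -> QTbar Om T y t.
  by move=> Omy ?; split=> //; exact: closure_subset.
have [r [r0 Omr]] := oOm x Omx.
have [d [d0 Wd]] := cW x 0 (bar x 0 Omx ltac:(lra)) (eps / 2) ltac:(lra).
(* Half of [d] is for the shift in space, the other half for the time [t] chosen below. *)
have rd0 : 0 < Rmin r (d / 2) by apply: Rmin_pos; lra.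
exists (mkposreal _ rd0) => h h0 /= hrd.
have hr := Rlt_le_trans _ _ _ hrd (Rmin_l _ _).
have hd := Rlt_le_trans _ _ _ hrd (Rmin_r _ _).
have Om_shift s : Rabs s <= Rabs h -> Om (shift x i s).
  by move=> sh; apply: Omr; rewrite dist_shift; lra.
have h_pos : 0 < Rabs h by apply: Rabs_pos_lt.
(* Replacing time 0 by [t] at both ends of the segment costs at most 2 e = eps |h| / 4; the
   variation of [W] costs eps |h| / 2, and the sum is below eps |h|. *)
set e := eps * Rabs h / 8; have e0 : 0 < e by rewrite /e; nra.
have Omh := Om_shift h (Rle_refl _).
have [d1 [d1_0 w1]] := cw x 0 (bar x 0 Omx ltac:(lra)) e e0.
have [d2 [d2_0 w2]] := cw _ 0 (bar _ 0 Omh ltac:(lra)) e e0.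
set t := Rmin (Rmin T (d / 2)) (Rmin d1 d2) / 2.
have [t0 tT td t1 t2] : [/\ 0 < t, t < T, t < d / 2, t < d1 & t < d2].
  have := Rmin_l (Rmin T (d / 2)) (Rmin d1 d2); have := Rmin_r (Rmin T (d / 2)) (Rmin d1 d2).
  have := Rmin_l T (d / 2); have := Rmin_r T (d / 2).
  have := Rmin_l d1 d2; have := Rmin_r d1 d2.
  have : 0 < Rmin (Rmin T (d / 2)) (Rmin d1 d2) by do ![apply: Rmin_pos]; lra.
  by rewrite /t => *; split; lra.
have abs_t : Rabs (t - 0) = t by rewrite Rminus_0_r Rabs_pos_eq //; lra.
have der s : Rmin 0 h <= s <= Rmax 0 h ->
    is_derive (fun s => w (shift x i s) t) s (W (shift x i s) t).
  move=> sh; apply/(partial_shift (fun z => w z t)); apply: dw; split; last lra.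
  apply: Om_shift; move: sh; rewrite /Rmin /Rmax /Rabs.
  by do !case: Rcase_abs => ?; case: Rle_dec => ?; lra.
(* The mean value theorem is applied at time [t > 0], since differentiability is known only in the
   open cylinder. *)
have [|s sh|s [sh mvt]] := MVT_gen (fun s => w (shift x i s) t) 0 h (fun s => W (shift x i s) t).
- by move=> s sh; apply: der; lra.
- apply/continuity_pt_filterlim; apply: ex_derive_continuous.
  by exists (W (shift x i s) t); exact: der.
have sh' : Rabs s <= Rabs h.
  move: sh; rewrite /Rmin /Rmax /Rabs.
  by do !case: Rcase_abs => ?; case: Rle_dec => ?; lra.
have Wst : Rabs (W (shift x i s) t - W x 0) < eps / 2.
  apply: Wd; first by apply: bar; [exact: Om_shift | lra].
  by apply: Rle_lt_trans (dist2_shift _ _ _ _ _) _; rewrite abs_t; lra.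
have := w1 x t (bar x t Omx ltac:(lra)); rewrite dist2_time abs_t => /(_ t1).
have := w2 _ t (bar _ t Omh ltac:(lra)); rewrite dist2_time abs_t => /(_ t2).
move: mvt => /=; rewrite shift0 Rminus_0_r Rplus_0_l.
set w10 := w (shift x i h) 0; set w1t := w (shift x i h) t; set w00 := w x 0; set w0t := w x t.
move=> mvt lt1 lt2.
have -> : (w10 - w00) / h - W x 0 =
  ((W (shift x i s) t - W x 0) * h - (w1t - w10) + (w0t - w00)) / h.
  have -> : (W (shift x i s) t - W x 0) * h = w1t - w0t - W x 0 * h by rewrite mvt; ring.
  by field.
rewrite Rabs_div //; apply/Rlt_div_l => //.
have : Rabs ((W (shift x i s) t - W x 0) * h) <= eps / 2 * Rabs h.
  by rewrite Rabs_mult; apply: Rmult_le_compat_r; lra.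
move: lt1 lt2; rewrite /e.
set u := _ * h; set v := w1t - _; set z := w0t - _; have : 0 < eps * Rabs h by nra.
have := Rabs_triang (u - v) z; have := Rabs_triang u (- v); rewrite Rabs_Ropp /Rminus; lra.
Qed.

(** Schwarz's theorem for [g] restricted to the plane through [x] in the directions i and j. Shifts
    below r / 2 in each direction stay in the ball of radius r. *)
Lemma hessian_sym n (U : Rn n -> Prop) g G H (x : Rn n) i j :
  is_open U -> C2_on U g G H -> U x -> H i j x = H j i x.
Proof.
move=> oU [dg [dG [_ [_ cH]]]] Ux.
have [-> // | ij] := eqVneq i j.
have [r [r0 Ur]] := oU x Ux; pose pt a b := shift (shift x i a) j b.
have r2 : 0 < r / 2 by lra.
have Upt a b : Rabs a < r / 2 -> Rabs b < r / 2 -> U (pt a b).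
  by move=> ar br; apply: Ur; apply: Rle_lt_trans (dist_shift2 _ _ _ ij) _; lra.
have near0 (P : R -> Prop) a : Rabs a < r / 2 ->
    (forall a', Rabs a' < r / 2 -> P a') -> locally a P.
  move=> ar Pa; have e0 : 0 < r / 2 - Rabs a by lra.
  exists (mkposreal _ e0) => a' aa'; apply: Pa.
  have {}aa' : Rabs (a' - a) < r / 2 - Rabs a by exact: aa'.
  by have := Rabs_triang (a' - a) a; rewrite Rplus_assoc Rplus_opp_l Rplus_0_r; lra.
have d_i F F' a b : is_partial F i (pt a b) F' -> is_derive (fun s => F (pt s b)) a F'.
  rewrite /pt shift_comm => /partial_shift; apply: is_derive_ext => s.
  by rewrite shift_comm.
have d_j F F' a b : is_partial F j (pt a b) F' -> is_derive (fun s => F (pt a s)) b F'.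
  by move/partial_shift.
pose f a b := g (pt a b).
have f_i a b : Rabs a < r / 2 -> Rabs b < r / 2 -> is_derive (fun s => f s b) a (G i (pt a b)).
  by move=> ar br; apply: d_i; apply: dg; apply: Upt.
have f_j a b : Rabs a < r / 2 -> Rabs b < r / 2 -> is_derive (fun s => f a s) b (G j (pt a b)).
  by move=> ar br; apply: d_j; apply: dg; apply: Upt.
(* [Schwarz] speaks of iterated [Derive]; the inner one agrees with the first partial derivative
   only near the point, hence the local extensionality. *)
have f_ji a b : Rabs a < r / 2 -> Rabs b < r / 2 ->
    is_derive (fun z => Derive (fun t => f z t) b) a (H j i (pt a b)).
  move=> ar br; apply: (is_derive_ext_loc (fun z => G j (pt z b))).
    by apply: near0 => // a' a'r; symmetry; apply: is_derive_unique; apply: f_j.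
  by apply: d_i; apply: dG; apply: Upt.
have f_ij a b : Rabs a < r / 2 -> Rabs b < r / 2 ->
    is_derive (fun z => Derive (fun t => f t z) a) b (H i j (pt a b)).
  move=> ar br; apply: (is_derive_ext_loc (fun z => G i (pt a z))).
    by apply: near0 => // b' b'r; symmetry; apply: is_derive_unique; apply: f_i.
  by apply: d_j; apply: dG; apply: Upt.
have R00 : Rabs 0 < r / 2 by rewrite Rabs_R0.
have pt0 : pt 0 0 = x by rewrite /pt !shift0.
have cont_pt k l (F : R -> R -> R) :
    (forall a b, Rabs a < r / 2 -> Rabs b < r / 2 -> F a b = H k l (pt a b)) ->
    continuity_2d_pt F 0 0.
  move=> eqF eps; have [d [d0 Hd]] := cH k l x Ux eps (cond_pos eps).
  have e0 : 0 < Rmin (r / 2) (d / 2) by apply: Rmin_pos; lra.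
  exists (mkposreal _ e0) => a b /=; rewrite !Rminus_0_r => a_lt b_lt.
  have [ar br] := conj (Rlt_le_trans _ _ _ a_lt (Rmin_l _ _)) (Rlt_le_trans _ _ _ b_lt (Rmin_l _ _)).
  have [ad bd] := conj (Rlt_le_trans _ _ _ a_lt (Rmin_r _ _)) (Rlt_le_trans _ _ _ b_lt (Rmin_r _ _)).
  rewrite !eqF // pt0; apply: Hd; first exact: Upt.
  by apply: Rle_lt_trans (dist_shift2 _ _ _ ij) _; lra.
have := Schwarz f 0 0; rewrite (is_derive_unique _ _ _ (f_ji _ _ R00 R00)).
rewrite (is_derive_unique _ _ _ (f_ij _ _ R00 R00)) pt0 => schwarz; symmetry; apply: schwarz.
- exists (mkposreal _ r2) => a b /=; rewrite !Rminus_0_r => ar br; split; last split; last split.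
  + by exists (G i (pt a b)); apply: f_i.
  + by exists (G j (pt a b)); apply: f_j.
  + by exists (H j i (pt a b)); apply: f_ji.
  + by exists (H i j (pt a b)); apply: f_ij.
- by apply: (cont_pt j i) => a b ar br; apply: is_derive_unique; apply: f_ji.
- by apply: (cont_pt i j) => a b ar br; apply: is_derive_unique; apply: f_ij.
Qed.

(** * Contradiction with the equation at a frontier point at time 0 *)

Theorem theorem3p2 (n m : nat) (Om : Rn n -> Prop) (T : R)
  (f phi : Rn n -> R -> R) (nu : R)
  (G : 'I_n -> Rn n -> R) (H : 'I_n -> 'I_n -> Rn n -> R) (x0 x1 : Rn n) :
  bounded_domain Om ->
  (1 <= m)%nat -> (m <= n)%nat -> 0 < T ->
  C2_on Om (fun x => phi x 0) G H ->
  0 < nu -> (forall x t, QTbar Om T x t -> nu <= f x t) ->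
  Om x0 -> kpositive (m.-1) (fun i j => H i j x0) ->
  Om x1 -> ~ kpositive (m.-1) (fun i j => H i j x1) ->
  ~ (exists (u : Rn n -> R -> R) (Ux : 'I_n -> Rn n -> R -> R)
        (Uxx : 'I_n -> 'I_n -> Rn n -> R -> R) (Ut : Rn n -> R -> R),
        C21_bar Om T u Ux Uxx Ut /\
        (forall x t, QTbar Om T x t -> Em m (Ut x t) (fun i j => Uxx i j x t) = f x t) /\
        (forall x t, parab_bd Om T x t -> u x t = phi x t)).
Proof.
move=> [oOm [cOm _]] m1 _ T0 C2phi nu0 f_ge Omx0 kpos0 Omx1 Nkpos1.
have [dphi [dG [_ [_ cH]]]] := C2phi.
case=> u [Ux [Uxx [Ut [[du [dUx [_ [cu [cUx [cUxx _]]]]]] [eq_E bd_u]]]]].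
have [x [Omx Nkpos lim]] : exists x, [/\ Om x, ~ kpositive m.-1 (fun i j => H i j x) &
    forall r, 0 < r -> exists y,
      [/\ Om y, dist x y < r & kpositive m.-1 (fun i j => H i j y)]].
  apply: (exists_frontier_point oOm cOm _ Omx0 kpos0 Omx1 Nkpos1) => x Omx.
  exact: kpositive_near.
have [] := Tp_boundary_cone cH _ Omx lim Nkpos.
  by move=> y Omy i j; exact: hessian_sym oOm C2phi Omy.
rewrite (prednK m1) => Tm1 Tm.
(* Needed on all of [Om], not only at [x], because it is differentiated once more for [Uxx_H]. *)
have Ux_G i y : Om y -> Ux i y 0 = G i y.
  move=> Omy; apply: is_partial_unique (dphi y Omy i).
  apply: (@is_partial_near _ Om (fun z => u z 0)) => // [z Omz|].
    by apply: bd_u; left.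
  exact: is_partial_initial oOm T0 (fun z t q => du z t q i) cu (cUx i) Omy.
have Uxx_H i j : Uxx i j x 0 = H i j x.
  apply: is_partial_unique (dG x Omx i j).
  apply: (@is_partial_near _ Om (fun z => Ux i z 0)) => // [z Omz|]; first exact: Ux_G.
  exact: is_partial_initial oOm T0 (fun z t q => dUx z t q i j) (cUx i) (cUxx i j) Omx.
(* At (x, 0) the coefficient T_(m-1) of u_t is zero, so whatever u_t is there, the equation reads f
   = T_m <= 0, against f >= nu > 0. *)
have bar0 : QTbar Om T x 0 by split; [exact: closure_subset | lra].
have := f_ge x 0 bar0; rewrite -(eq_E x 0 bar0) /Em.
have -> : (fun i j => Uxx i j x 0) = (fun i j => H i j x).
  by do 2!apply: functional_extensionality => ?; exact: Uxx_H.
by rewrite Tm1; lra.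
Qed.
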